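(* Let $T$ be the tessellation of $\mathbb{R}^k$ given by a lattice, and let $c$ be a cell of $T$ such that the reflection $c'$ of $c$ across one of the facets of $c$ (i.e. across the hyperplane spanned by that facet) is again a cell of $T$. If there are abutting facets of $c$ that meet with an obtuse angle, then $\chi(T)$ is not refinable.
   Context: A lattice $L$ in $\mathbb{R}^k$ is a discrete subgroup of full rank; it is identified with the tessellation $T$ of $\mathbb{R}^k$ by its Voronoi cells, i.e. the translates $V+l$, $l\in L$, of $V=\{x: |x|\le |x-l'| \text{ for all } l'\in L\}$. Facets are $(k-1)$-dimensional faces of cells; two facets of a cell abut if they share a $(k-2)$-dimensional face, and they meet with an obtuse angle if the interior dihedral angle there exceeds $\pi/2$, equivalently if their outer normals have strictly positive inner product. For $\lambda>0$, $\lambda T=\{\lambda c : c\in T\}$. $\chi(T)$ denotes the space of indicator functions of the cells of $T$. $\chi(T)$ is refinable if, for some fixed $0<\lambda<1$, the indicator function of every cell of $T$ is a linear combination of indicator functions of cells of the smaller-scale copy $\lambda T$; not refinable means that this holds for no $0<\lambda<1$. Linear combinations may be infinite (the sums are locally finite), and equality of functions is understood almost everywhere. *)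

(* Defs.v *)
(* R^k is represented by 'rV[R]_k with R : realType. *)
From HB Require Import structures.
From mathcomp Require Import all_boot all_order all_algebra.
From mathcomp Require Import all_classical all_reals all_analysis.

Set Implicit Arguments.
Unset Strict Implicit.
Unset Printing Implicit Defensive.

Import Order.TTheory GRing.Theory Num.Theory.
Import numFieldNormedType.Exports.

Local Open Scope classical_set_scope.
Local Open Scope ring_scope.

Section Euclidean.
Context {R : realType} {k : nat}.
Implicit Types (u v x : 'rV[R]_k) (S : set 'rV[R]_k).

Definition dot u v : R := \sum_(i < k) u 0 i * v 0 i.

(* The library norm `|x| on 'rV[R]_k is the sup norm. *)
Definition enorm x : R := Num.sqrt (dot x x).

Definition hyperplane u (b : R) : set 'rV[R]_k := [set x | dot u x = b].

(* Orthogonal reflection across [hyperplane u b], for u != 0. *)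
Definition reflection u (b : R) x : 'rV[R]_k :=
  x - (2 * (dot u x - b) / dot u u) *: u.

Definition aff_hull S : set 'rV[R]_k :=
  [set x | exists (n : nat) (w : 'I_n -> R) (p : 'I_n -> 'rV[R]_k),
    [/\ \sum_(i < n) w i = 1, forall i, S (p i) & x = \sum_(i < n) w i *: p i]].

Definition has_dim S (d : nat) : Prop :=
  exists (p : 'rV[R]_k) (M : 'M[R]_(d, k)),
    row_free M /\ aff_hull S = [set p + v | v in [set v | (v <= M)%MS]].

(* S has dimension k - m; stated additively, so that it is false when m > k. *)
Definition has_codim S (m : nat) : Prop :=
  exists d : nat, (d + m)%N = k /\ has_dim S d.

End Euclidean.

Section LebesgueNull.
Context {R : realType} {k : nat}.

Definition open_box (a b : 'rV[R]_k) : set 'rV[R]_k :=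
  [set x | forall i, a 0 i < x 0 i < b 0 i].

(* Null sets of k-dimensional Lebesgue measure: for every e > 0 there is a
   countable cover by boxes of total volume at most e. The index set D lets the
   cover be finite or empty. *)
Definition lebesgue_null (N : set 'rV[R]_k) : Prop :=
  forall e : R, 0 < e ->
  exists (D : set nat) (a b : nat -> 'rV[R]_k),
    [/\ forall n i, D n -> a n 0 i <= b n 0 i,
        N `<=` \bigcup_(n in D) open_box (a n) (b n) &
        (\esum_(n in D) (\prod_(i < k) (b n 0 i - a n 0 i))%:E <= e%:E)%E].

Definition almost_everywhere (P : 'rV[R]_k -> Prop) : Prop :=
  lebesgue_null [set x | ~ P x].

End LebesgueNull.

Section Tessellation.
Context {R : realType} {k : nat}.
Implicit Types (L c F G : set 'rV[R]_k) (T : set (set 'rV[R]_k)).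

Definition is_lattice L : Prop :=
  [/\ L 0,
      forall x y, L x -> L y -> L (x - y),
      L `<=` isolated L &
      exists B : 'M[R]_k, B \in unitmx /\ forall i, L (row i B)].

Definition voronoi L : set 'rV[R]_k :=
  [set x | forall l, L l -> enorm x <= enorm (x - l)].

Definition tessellation L : set (set 'rV[R]_k) :=
  [set [set v + l | v in voronoi L] | l in L].

Definition scaled (lam : R) T : set (set 'rV[R]_k) :=
  [set [set lam *: x | x in c] | c in T].

(* The sum over cells is possibly infinite; at each point x it is the sum over
   its finite support, which is contained in the finitely many cells
   containing x when T is the tessellation of a lattice. *)
Definition refinable T : Prop :=
  exists lam : R, 0 < lam < 1 /\
    forall c, T c -> exists a : set 'rV[R]_k -> R,
      almost_everywhere
        (fun x => \1_c x = \sum_(d \in scaled lam T) a d * \1_d x).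

Definition supports c (u : 'rV[R]_k) (b : R) F : Prop :=
  (forall x, c x -> dot u x <= b) /\ F = c `&` hyperplane u b.

(* Taking u = 0 also gives the improper faces c and set0. *)
Definition face c F : Prop := exists u b, supports c u b F.

Definition facet c F : Prop := face c F /\ has_codim F 1.

(* F <> G is needed: a facet shares its own (k-2)-faces with itself. *)
Definition abut c F G : Prop :=
  [/\ facet c F, facet c G, F <> G &
      exists E, [/\ face F E, face G E & has_codim E 2]].

Definition outer_normal c F (u : 'rV[R]_k) : Prop :=
  u != 0 /\ exists b, supports c u b F.

(* The interior dihedral angle is pi minus the angle between outer normals. *)
Definition dihedral_angle (u v : 'rV[R]_k) : R :=
  pi - acos (dot u v / (enorm u * enorm v)).

(* Outer normals of a facet of a full-dimensional cell are unique up to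
   positive scaling, so the choice of u and v is immaterial. *)
Definition obtuse c F G : Prop :=
  exists u v, [/\ outer_normal c F u, outer_normal c G v &
                  pi / 2 < dihedral_angle u v].

(* [hyperplane u b] with u != 0 is the hyperplane spanned by the facet F. *)
Definition facet_reflection c F c' : Prop :=
  exists u b, [/\ u != 0, aff_hull F = hyperplane u b &
                  c' = [set reflection u b x | x in c]].

End Tessellation.

(* Main.v *)
(* If the indicator function of the Voronoi cell V of L is a combination of
   indicator functions of the small cells lam (V + m), then each small cell whose
   interior meets the interior of V lies in V, and these small cells cover V.
   Let F and G be facets of V with outer normals u and v, u.v > 0; v may be
   chosen in L, so that V + v is the cell behind G. A small cell lam (V + m)
   inside V that touches F has its own F-facet on the hyperplane of F, so its
   neighbour lam (V + m + v) crosses that hyperplane and has no interior point in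
   V. Hence the facet between these two small cells lies on the hyperplane of G.
   Every point of F is therefore obtained from a point of F by a homothety of
   ratio lam which preserves the hyperplane of G; iterating, F, being bounded,
   lies in that hyperplane. By symmetry F = G, contradicting F <> G. *)
Require Import Defs.
From mathcomp Require Import all_boot all_order all_algebra.
From mathcomp Require Import all_classical all_reals all_analysis.
From mathcomp Require Import measurable_realfun ring lra.

Set Implicit Arguments.
Unset Strict Implicit.
Unset Printing Implicit Defensive.

Import Order.TTheory GRing.Theory Num.Theory.
Import numFieldNormedType.Exports.

Local Open Scope classical_set_scope.
Local Open Scope ring_scope.

(** * Nonempty open sets are not null *)

(** Integrate the pointwise bound over [s, t], exchange sum and integral, and note that each
    interval meets [s, t] in length at most [b n - a n]. This integrates out one coordinate of a box
    cover. *)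
Lemma ge0_nneseries_integral_le (R : realType) (a b : nat -> R) (h : nat -> \bar R) (C s t : R) :
  s <= t -> 0 <= C -> (forall n, a n <= b n) -> (forall n, (0 <= h n)%E) ->
  (forall n, h n \is a fin_num) ->
  (forall y, s <= y <= t -> (C%:E <= \sum_(n <oo) h n * (\1_(`]a n, b n[) y)%:E)%E) ->
  ((C * (t - s))%:E <= \sum_(n <oo) h n * (b n - a n)%:E)%E.
Proof.
move=> st C0 ab h0 hf cov.
have mD : measurable (`[s, t]%classic : set (measurableTypeR R)) by exact: measurable_itv.
pose mu := @lebesgue_measure R.
have -> : (C * (t - s))%:E = (\int[mu]_(x in `[s, t]) C%:E)%E.
  rewrite integral_cst//= lebesgue_measure_itv/= lte_fin EFinM.
  case: ltP => // ts; have -> : t = s by apply/le_anti; rewrite st ts.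
  by rewrite subrr.
apply: (@le_trans _ _ (\int[mu]_(x in `[s, t]) (\sum_(n <oo) h n * (\1_(`]a n, b n[) x)%:E))%E).
  apply: ge0_le_integral => //=.
  - apply: ge0_emeasurable_sum.
      by move=> n x _ _; rewrite mule_ge0 ?lee_fin.
    move=> n _; apply: measurable_funeM; apply/measurable_EFinP.
    by apply: measurable_indic; exact: measurable_itv.
rewrite integral_nneseries//=; last 2 first.
- move=> n; apply: measurable_funeM; apply/measurable_EFinP.
  by apply: measurable_indic; exact: measurable_itv.
- by move=> n x _; rewrite mule_ge0 ?lee_fin.
apply: lee_nneseries => [n _ _|n _].
  by apply: integral_ge0 => x _; rewrite mule_ge0 ?lee_fin.
rewrite -(fineK (hf n)) ge0_integralZl_EFin//=; last 2 first.
- by apply/measurable_EFinP; apply: measurable_indic; exact: measurable_itv.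
- by apply: fine_ge0.
rewrite integral_indic//=.
apply: lee_pmul; rewrite ?lee_fin ?fine_ge0//.
apply: (@le_trans _ _ (mu `]a n, b n[%classic)).
  by apply: le_measure; rewrite ?inE//; apply: measurableI.
rewrite /mu lebesgue_measure_itv/= lte_fin; case: ltP => // _.
by rewrite lee_fin subr_ge0.
Qed.

(** Coordinates are integrated out one after another, so that one-dimensional Lebesgue measure
    suffices. *)
Lemma box_cover_volume_le (R : realType) (k : nat) (a b : nat -> 'I_k -> R)
    (c : nat -> R) (p q : 'I_k -> R) :
  (forall n i, a n i <= b n i) -> (forall n, 0 <= c n) ->
  (forall i, p i <= q i) ->
  (forall x : 'I_k -> R, (forall i, p i <= x i <= q i) ->
    (1 <= \sum_(n <oo) (c n * \prod_i \1_(`]a n i, b n i[) (x i))%:E)%E) ->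
  ((\prod_i (q i - p i))%:E <=
    \sum_(n <oo) (c n * \prod_i (b n i - a n i))%:E)%E.
Proof.
move=> ab c0 pq cov.
pose w j n (x : 'I_k -> R) (i : 'I_k) : R :=
  if (i < j)%N then b n i - a n i else \1_(`]a n i, b n i[) (x i).
have w0 j n x i : 0 <= w j n x i by rewrite /w; case: ifP => //; rewrite subr_ge0.
have step j : (j <= k)%N -> forall x, (forall i, p i <= x i <= q i) ->
    ((\prod_(i < k | (i < j)%N) (q i - p i))%:E <=
     \sum_(n <oo) (c n * \prod_i w j n x i)%:E)%E.
  elim: j => [_ x xpq|j IH jk x xpq].
    by rewrite big_pred0_eq; exact: cov.
  pose J := Ordinal jk.
  have wJ n : \prod_i w j.+1 n x i =
      (\prod_(i | i != J) w j n x i) * (b n J - a n J).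
    rewrite (bigD1 J)//= mulrC {2}/w ltnSn; congr (_ * _).
    apply: eq_bigr => i iJ; rewrite /w ltnS leq_eqVlt.
    by rewrite (_ : (i == j :> nat) = false)//; apply/negbTE.
  have -> : \prod_(i < k | (i < j.+1)%N) (q i - p i) =
      \prod_(i < k | (i < j)%N) (q i - p i) * (q J - p J).
    rewrite (bigD1 J)//= mulrC; congr (_ * _).
    apply: eq_bigl => i; rewrite ltnS ltn_neqAle andbC; congr (_ && _).
  rewrite (eq_eseriesr (g := fun n => ((c n * \prod_(i | i != J) w j n x i)%:E *
      (b n J - a n J)%:E)%E)); last by move=> n _; rewrite wJ mulrA EFinM.
  apply: ge0_nneseries_integral_le => //.
  - by apply: prodr_ge0 => i _; rewrite subr_ge0.
  - by move=> n; rewrite lee_fin mulr_ge0// prodr_ge0.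
  move=> y ypq.
  pose xy i := if i == J then y else x i.
  have xypq i : p i <= xy i <= q i by rewrite /xy; case: eqP => [->|].
  apply: le_trans (IH (ltnW jk) xy xypq) _.
  rewrite le_eqVlt; apply/orP; left; apply/eqP/eq_eseriesr => n _.
  rewrite -EFinM -mulrA; congr (_ * _)%:E.
  rewrite (bigD1 J)//= mulrC; congr (_ * _).
    apply: eq_bigr => i iJ; rewrite /w /xy (negbTE iJ)//.
  by rewrite /w ltnn /xy eqxx.
have -> : \prod_i (q i - p i) = \prod_(i < k | (i < k)%N) (q i - p i).
  by apply: eq_bigl => i; rewrite ltn_ord.
apply: le_trans (step k (leqnn k) p _) _ => [i|]; first by rewrite lexx pq.
rewrite le_eqVlt; apply/orP; left; apply/eqP/eq_eseriesr => n _; congr (_ * _)%:E.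
by apply: eq_bigr => i _; rewrite /w ltn_ord.
Qed.

Lemma open_box_not_null (R : realType) (k : nat) (p q : 'rV[R]_k) :
  (forall i, p 0 i < q 0 i) ->
  ~ lebesgue_null [set x | forall i, p 0 i <= x 0 i <= q 0 i].
Proof.
move=> pq null.
have v0 : 0 < \prod_i (q 0 i - p 0 i) by apply: prodr_gt0 => i _; rewrite subr_gt0.
have [D [a [b [ab cov]]]] := null _ (divr_gt0 v0 (@ltr0Sn R 1)).
apply/negP; rewrite -ltNge.
(* Off [D] the bounds are arbitrary, so they are reset to 0. The weight [(n \in D)%:R] discards
   these boxes even for [k = 0], where an empty product is 1. *)
pose a' n i := if n \in D then a n 0 i else 0.
pose b' n i := if n \in D then b n 0 i else 0.
have vE : \esum_(n in D) (\prod_(i < k) (b n 0 i - a n 0 i))%:E =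
    (\sum_(n <oo) ((n \in D)%:R * \prod_i (b' n i - a' n i))%:E)%E.
  rewrite -[in LHS](set_mem_set D) -nneseries_esum; last first.
    move=> n; rewrite inE => Dn; rewrite lee_fin; apply: prodr_ge0 => i _.
    by rewrite subr_ge0; exact: ab.
  rewrite eseries_mkcond; apply: eq_eseriesr => n _.
  by rewrite /a' /b'; case: ifP => _; rewrite ?mul1r ?mul0r.
rewrite vE; apply: (@lt_le_trans _ _ (\prod_i (q 0 i - p 0 i))%:E).
  by rewrite lte_fin ltr_pdivrMr// mulr_natr mulr2n ltrDl.
apply: box_cover_volume_le.
- by move=> n i; rewrite /a' /b'; case: ifPn => //; rewrite inE => /ab.
- by move=> n; rewrite ler0n.
- by move=> i; exact/ltW.
move=> x xpq.
have [n Dn xn] := cov (\row_i x i) (fun i => ltac:(by rewrite mxE; exact: xpq)).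
have t0 m : (0 <= ((m \in D)%:R * \prod_i \1_(`]a' m i, b' m i[) (x i))%:E :> \bar R)%E.
  by rewrite lee_fin mulr_ge0// prodr_ge0.
apply: (@le_trans _ _ (\sum_(0 <= m < n.+1)
    ((m \in D)%:R * \prod_i \1_(`]a' m i, b' m i[) (x i))%:E)%E).
  rewrite big_nat_recr//= -[leLHS]add0e leeD//; first by apply: sume_ge0.
  rewrite mem_set// mul1r lee_fin big1// => i _.
  rewrite indicE mem_set//= in_itv/= /a' /b' mem_set//.
  by have := xn i; rewrite mxE.
by apply: nneseries_lim_ge => m _ _; exact: t0.
Qed.

(** A neighbourhood contains a closed cube, which is not null. This is how almost everywhere
    identities get evaluated at points. *)
Lemma almost_everywhere_ball (R : realType) (k : nat) (P : 'rV[R]_k -> Prop)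
    (U : set 'rV[R]_k) (z : 'rV[R]_k) :
  Defs.almost_everywhere P -> nbhs z U -> exists2 x, U x & P x.
Proof.
move=> aeP /nbhs_ballP[e /= e0 eU].
apply: contrapT => nP.
pose p : 'rV[R]_k := \row_i (z 0 i - e / 2).
pose q : 'rV[R]_k := \row_i (z 0 i + e / 2).
have pq i : p 0 i < q 0 i by rewrite !mxE; lra.
apply: (open_box_not_null pq) => d d0.
have [D [a [b [ab cov vol]]]] := aeP d d0.
exists D, a, b; split => // x xpq; apply: cov => /= Px; apply: nP; exists x => //.
apply: eU; split => // i j; rewrite /ball/= (ord1 i) ltr_distlC.
by have := xpq j; rewrite !mxE; lra.
Qed.

(** * Inner product and affine hulls *)

Section Dot.
Context {R : realType} {k : nat}.
Implicit Types (x y z u v w : 'rV[R]_k) (t : R).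

Lemma dotC x y : dot x y = dot y x.
Proof. by apply: eq_bigr => i _; rewrite mulrC. Qed.

Lemma dotDl x y z : dot (x + y) z = dot x z + dot y z.
Proof. by rewrite -big_split; apply: eq_bigr => i _; rewrite mxE mulrDl. Qed.

Lemma dotZl t x y : dot (t *: x) y = t * dot x y.
Proof. by rewrite /dot mulr_sumr; apply: eq_bigr => i _; rewrite mxE mulrA. Qed.

Lemma dotNl x y : dot (- x) y = - dot x y.
Proof. by rewrite -scaleN1r dotZl mulN1r. Qed.

Lemma dotDr x y z : dot z (x + y) = dot z x + dot z y.
Proof. by rewrite dotC dotDl !(dotC z). Qed.

Lemma dotZr t x y : dot x (t *: y) = t * dot x y.
Proof. by rewrite dotC dotZl dotC. Qed.

Lemma dotNr x y : dot x (- y) = - dot x y.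
Proof. by rewrite dotC dotNl dotC. Qed.

Lemma dot0l x : dot 0 x = 0.
Proof. by rewrite -(scale0r x) dotZl mul0r. Qed.

Definition dotE := (dotDl, dotDr, dotNl, dotNr, dotZl, dotZr).

Lemma dot_ge0 x : 0 <= dot x x.
Proof. by apply: sumr_ge0 => i _; rewrite -expr2 sqr_ge0. Qed.

Lemma coord_le_norm x i : `|x 0 i| <= `|x|.
Proof.
by rewrite [leRHS]/Num.Def.normr /= mx_normrE; apply/bigmax_geP; right; exists (0, i).
Qed.

Lemma norm_le_coord x t : 0 <= t -> (forall i, `|x 0 i| <= t) -> `|x| <= t.
Proof.
move=> t0 xt; rewrite [leLHS]/Num.Def.normr /= mx_normrE; apply/bigmax_leP; split => //.
by move=> [i j] _ /=; rewrite (ord1 i).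
Qed.

(** The topology comes from the sup norm; this bound and [dot_norm_le] compare it with the Euclidean
    product. *)
Lemma norm_sqr_le_dot x : `|x| ^+ 2 <= dot x x.
Proof.
have [->|x0] := eqVneq x 0; first by rewrite normr0 expr0n dot0l.
have [[i j] /= nx] := @mx_norm_neq0 _ _ _ x ltac:(by apply: contra_neq x0 => /mx_norm_eq0).
rewrite [`|x|]nx (ord1 i) real_normK ?num_real// /dot (bigD1 j)//= expr2 lerDl.
by apply: sumr_ge0 => l _; rewrite -expr2 sqr_ge0.
Qed.

Lemma dot_gt0 x : x != 0 -> 0 < dot x x.
Proof.
by move=> x0; apply: lt_le_trans (norm_sqr_le_dot x); rewrite exprn_gt0 ?normr_gt0.
Qed.

Lemma dot_norm_le x y : `|dot x y| <= k%:R * (`|x| * `|y|).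
Proof.
apply: le_trans (ler_norm_sum _ _ _) _.
apply: (@le_trans _ _ (\sum_(i < k) `|x| * `|y|)).
  by apply: ler_sum => i _; rewrite normrM ler_pM// coord_le_norm.
by rewrite sumr_const card_ord mulr_natl.
Qed.

Lemma enorm_le x y : (enorm x <= enorm y) = (dot x x <= dot y y).
Proof. by rewrite ler_sqrt// dot_ge0. Qed.

(** One half of Cauchy-Schwarz, from expanding the square of [enorm v *: u + enorm u *: v]. *)
Lemma dot_ge_enorm u v : - (enorm u * enorm v) <= dot u v.
Proof.
have sq w : enorm w ^+ 2 = dot w w by rewrite sqr_sqrtr// dot_ge0.
have [u0|u0] := eqVneq u 0.
  by rewrite u0 /enorm !dot0l sqrtr0 mul0r oppr0.
have [v0|v0] := eqVneq v 0.
  by rewrite v0 /enorm dotC !dot0l sqrtr0 mulr0 oppr0.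
have eu : 0 < enorm u by rewrite sqrtr_gt0 dot_gt0.
have ev : 0 < enorm v by rewrite sqrtr_gt0 dot_gt0.
have := dot_ge0 (enorm v *: u + enorm u *: v).
have -> : dot (enorm v *: u + enorm u *: v) (enorm v *: u + enorm u *: v) =
    (2 * enorm u * enorm v) * (dot u v + enorm u * enorm v).
  by rewrite !dotE (dotC v u) -!sq; ring.
by rewrite pmulr_rge0 ?mulr_gt0// -[in X in _ -> X]subr_ge0 opprK.
Qed.

Lemma obtuse_dot_gt0 u v : pi / 2 < dihedral_angle u v -> 0 < dot u v.
Proof.
case: (ltP 0 (dot u v)) => // uv0; rewrite /dihedral_angle.
set c := dot u v / _ => obt.
have e0 : 0 <= enorm u * enorm v by apply: mulr_ge0; exact: sqrtr_ge0.
have c0 : c <= 0 by rewrite mulr_le0_ge0 ?invr_ge0.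
have c1 : -1 <= c.
  (* A zero denominator gives [c = 0], because the inverse of 0 is 0. *)
  have [e1|e1] := eqVneq (enorm u * enorm v) 0.
    by rewrite /c e1 invr0 mulr0 lerN10.
  by rewrite /c ler_pdivlMr ?lt_def ?e1// mulN1r dot_ge_enorm.
have [/andP[a0 api] ca] := @acos_def R c ltac:(by rewrite c1 (le_trans c0)).
have pi0 := @pi_gt0 R.
have : cos (pi / 2) < cos (acos c) by rewrite ltr_cos ?in_itv/= ?a0//; lra.
by rewrite ca cos_pihalf ltNge c0.
Qed.

Lemma dot_continuous y : continuous (fun x => dot x y).
Proof.
rewrite /dot; apply: continuous_big => [|i _ x]; first exact: add_continuous.
apply: cvgMr_tmp; [exact: (nbhs_filter x)|exact: coord_continuous].
Qed.

(** A vector with constant product on [F] is orthogonal to the direction space of its affine hull.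
    That space has dimension [k - 1], so its orthogonal complement is the line of [u]. *)
Lemma codim1_normal_parallel (F : set 'rV[R]_k) u w (b c : R) :
  has_codim F 1 -> u != 0 -> (forall x, F x -> dot u x = b) ->
  (forall x, F x -> dot w x = c) -> exists t, w = t *: u.
Proof.
move=> [d [dk [p [M [Mfree affF]]]]] u0 Fu Fw.
have ker v e : (forall x, F x -> dot v x = e) -> v *m M^T = 0.
  move=> Fv.
  have aff x : aff_hull F x -> dot v x = e.
    move=> [n [s [q [s1 Fq ->]]]].
    rewrite dotC /dot.
    transitivity (\sum_(i < n) s i * dot v (q i)).
      rewrite (eq_bigr (fun j => \sum_(i < n) s i * (v 0 j * q i 0 j))).
        by rewrite exchange_big; apply: eq_bigr => i _; rewrite /dot mulr_sumr.
      move=> j _; rewrite summxE mulr_suml; apply: eq_bigr => i _.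
      by rewrite mxE; ring.
    rewrite (eq_bigr (fun i => s i * e)); last by move=> i _; rewrite Fv.
    by rewrite -mulr_suml s1 mul1r.
  have pv : dot v p = e.
    by apply: aff; rewrite affF; exists 0; rewrite ?addr0//=; exact: sub0mx.
  apply/rowP => i; rewrite !mxE.
  have : dot v (p + row i M) = e.
    by apply: aff; rewrite affF; exists (row i M) => //=; exact: row_sub.
  rewrite dotDr pv -[in RHS](addr0 e) => /addrI vM.
  by rewrite -[RHS]vM; apply: eq_bigr => j _; rewrite !mxE.
apply/sub_rVP; have uker : (u <= kermx M^T)%MS by apply/sub_kermxP; exact: ker Fu.
have := mxrank_leqif_sup uker; rewrite mxrank_ker mxrank_tr (eqP Mfree).
have -> : (k - d = 1)%N by rewrite -dk addKn.
rewrite rank_rV u0 => -[_ /esym]; rewrite eqxx => kerw.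
by apply: submx_trans kerw; apply/sub_kermxP; exact: ker Fw.
Qed.

(** The affine hull contains [p], and weights summing to 1 cannot form an empty family. *)
Lemma codim_nonempty (F : set 'rV[R]_k) m : has_codim F m -> F !=set0.
Proof.
move=> [d [_ [p [M [_ affF]]]]].
have [[|n] [s [q [s1 Fq _]]]] : aff_hull F p.
  by rewrite affF; exists 0; rewrite ?addr0//=; exact: sub0mx.
- by move: s1; rewrite big_ord0 => /esym/eqP; rewrite oner_eq0.
- by exists (q ord0).
Qed.

End Dot.

(** * Lattices and their Voronoi cells *)

Lemma seq_uniform_eps (R : realFieldType) (T : eqType) (s : seq T) (Q : T -> R -> Prop) :
  (forall l d e, 0 < d -> d <= e -> Q l e -> Q l d) ->
  (forall l, l \in s -> exists2 d, 0 < d & Q l d) ->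
  exists2 d, 0 < d & forall l, l \in s -> Q l d.
Proof.
move=> mono; elim: s => [_|a s IH H]; first by exists 1.
have [l ls|d d0 sd] := IH; first by apply: H; rewrite inE ls orbT.
have [e e0 ae] := H a (mem_head _ _).
have m0 : 0 < Num.min d e by rewrite lt_min d0.
exists (Num.min d e) => // l; rewrite inE => /orP[/eqP->|ls].
  by apply: mono ae => //; rewrite ge_min lexx orbT.
by apply: mono (sd l ls) => //; rewrite ge_min lexx.
Qed.

Lemma seq_argmin (R : realFieldType) (T : eqType) (s : seq T) (f : T -> R) x :
  x \in s -> exists2 a, a \in s & forall l, l \in s -> f a <= f l.
Proof.
elim: s x => // b s IH x _; case: s IH => [_|c s IH].
  by exists b; rewrite ?mem_head// => l; rewrite inE => /eqP->.
have [a as_ amin] := IH c (mem_head _ _).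
have [fab|fba] := leP (f a) (f b).
  exists a; first by rewrite inE as_ orbT.
  by move=> l; rewrite inE => /orP[/eqP->//|]; exact: amin.
exists b; first exact: mem_head.
move=> l; rewrite inE => /orP[/eqP->//|/amin]; exact: le_trans (ltW fba).
Qed.

Section Lattice.
Context {R : realType} {k : nat} (L : set 'rV[R]_k).
Hypothesis latL : is_lattice L.
Implicit Types (x y z l m u w f g : 'rV[R]_k).

Lemma lattice0 : L 0. Proof. by case: latL. Qed.

Lemma latticeB x y : L x -> L y -> L (x - y).
Proof. by case: latL => _ + _ _; exact. Qed.

Lemma latticeN x : L x -> L (- x).
Proof. by move=> Lx; rewrite -sub0r; apply: latticeB => //; exact: lattice0. Qed.

Lemma latticeD x y : L x -> L y -> L (x + y).
Proof. by move=> Lx Ly; rewrite -[y]opprK; apply: latticeB => //; exact: latticeN. Qed.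

Lemma lattice_discrete : exists2 e : R, 0 < e & forall l, L l -> `|l| < e -> l = 0.
Proof.
have [_ _ Liso _] := latL.
have [_ [V /nbhs_ballP[e /= e0 eV] VL]] := Liso _ lattice0.
exists e => // l Ll le; have : (V `&` L) l.
  by split=> //; apply: eV; rewrite -ball_normE /ball_/= sub0r normrN.
by rewrite VL.
Qed.

Lemma lattice_finite (r : R) : finite_set [set l | L l /\ `|l| <= r].
Proof.
have [e e0 eL] := lattice_discrete.
pose N := Num.truncn ((r + r) / e).
(* Distinct lattice points fall in distinct cubes of side [e]. *)
pose cube l : {ffun 'I_k -> 'I_N.+1} :=
  [ffun i => inord (Num.truncn ((l 0 i + r) / e))].
pose pick c := xget 0 [set l | (L l /\ `|l| <= r) /\ cube l = c].
apply: (@sub_finite_set _ _ (pick @` setT)); last first.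
  by apply: finite_image; exact: finite_finset.
move=> l [Ll lr]; exists (cube l) => //.
rewrite /pick; case: xgetP => [h _ [[Lh hr] hl]|/(_ l)]; last by case.
apply/eqP; rewrite -subr_eq0; apply/eqP/eL; first exact: latticeB.
have bnd g i : `|g| <= r -> 0 <= (g 0 i + r) / e <= (r + r) / e.
  move=> gr; have := le_trans (coord_le_norm g i) gr; rewrite ler_norml => /andP[g1 g2].
  apply/andP; split; first by apply: divr_ge0; [lra|exact: ltW].
  by rewrite ler_pM2r ?invr_gt0//; lra.
rewrite [ltLHS]/Num.Def.normr/= mx_normrE; apply/bigmax_ltP; split => // -[j i] _ /=.
rewrite (ord1 j).
move/ffunP: hl => /(_ i); rewrite !ffunE => /(congr1 val).
have [h0 hN] := andP (bnd h i hr); have [l0 lN] := andP (bnd l i lr).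
rewrite /= !inordK ?ltnS ?le_truncn// => hl.
have /andP[] := truncn_itv h0; have /andP[] := truncn_itv l0; rewrite hl => l1 l2 h1 h2.
have : `|(h 0 i + r) / e - (l 0 i + r) / e| < 1.
  by rewrite ltr_norml; move: l2 h2; rewrite -natr1; lra.
rewrite -mulrBl normrM (gtr0_norm (_ : 0 < e^-1)) ?invr_gt0//.
by rewrite ltr_pdivrMr// mul1r !mxE; congr (`|_| < _); ring.
Qed.

(** After squaring, the terms quadratic in [x] cancel: the cell is an intersection of
    half-spaces. *)
Lemma voronoiP x : voronoi L x <-> forall l, L l -> 2 * dot x l <= dot l l.
Proof.
have eq l : (enorm x <= enorm (x - l)) = (2 * dot x l <= dot l l).
  by rewrite enorm_le !dotE (dotC l x); apply/idP/idP => ?; lra.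
by split => H l /H; rewrite eq.
Qed.

(** The interior of the cell. The vector 0 is excluded because its constraint would read 0 < 0. *)
Definition open_voronoi : set 'rV[R]_k :=
  [set x | forall l, L l -> l != 0 -> 2 * dot x l < dot l l].

Lemma open_voronoiW x : open_voronoi x -> voronoi L x.
Proof.
move=> Vx; apply/voronoiP => l Ll; have [->|l0] := eqVneq l 0.
  by rewrite dotC !dot0l mulr0.
exact/ltW/Vx.
Qed.

(** Only finitely many vectors are short, and each has its own margin. For [l] longer than [r], the
    square of the norm of [l] dominates the left side, which is linear in that norm. *)
Lemma lattice_slack (P : set 'rV[R]_k) x :
  P `<=` L -> (forall l, P l -> 2 * dot x l < dot l l) ->
  exists2 d, 0 < d & forall l, P l -> 2 * dot x l + d * `|l| <= dot l l.
Proof.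
move=> PL Px; pose r := 2 * (k%:R * `|x|) + 1.
have /finite_seqP[s sE] := lattice_finite r.
have [l d e d0 de + Pl|l _|d d0 sd] :=
    @seq_uniform_eps _ _ s (fun l d => P l -> 2 * dot x l + d * `|l| <= dot l l).
- by move=> /(_ Pl); apply: le_trans; rewrite lerD2l ler_wpM2r.
- have [Pl|nPl] := pselect (P l); last by exists 1.
  have [->|l0] := eqVneq l 0.
    by exists 1 => // _; rewrite dotC !dot0l normr0 !mulr0 addr0.
  have nl : 0 < `|l| by rewrite normr_gt0.
  exists ((dot l l - 2 * dot x l) / `|l|); first by rewrite divr_gt0// subr_gt0 Px.
  by move=> _; rewrite divfK ?gt_eqF// addrC subrK.
exists (Num.min d 1); first by rewrite lt_min d0 ltr01.
move=> l Pl; have [lr|rl] := leP `|l| r.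
  have ls : l \in s.
    by have : [set` s] l; [rewrite -sE; split => //; exact: PL|].
  apply: le_trans (sd l ls Pl); rewrite lerD2l ler_wpM2r//.
  by rewrite ge_min lexx.
apply: le_trans (norm_sqr_le_dot l).
apply: (@le_trans _ _ (r * `|l|)); last by rewrite expr2 ler_wpM2r// ltW.
rewrite /r [leRHS]mulrDl; apply: lerD; last first.
  by rewrite ler_wpM2r// ge_min lexx orbT.
rewrite -!mulrA ler_pM2l//; apply: le_trans (dot_norm_le x l).
exact: ler_norm.
Qed.

(** The slack grows linearly with the norm of [l], so one radius serves all constraints. The affine
    form covers both the cell itself and the small cells, where [s] is [lam^-1]. *)
Lemma open_voronoi_affine_nbhs (s : R) m z :
  open_voronoi (s *: z - m) -> nbhs z [set x | open_voronoi (s *: x - m)].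
Proof.
move=> Vz.
have [l []//|l [Ll l0]|d d0 slack] :=
  @lattice_slack [set l | L l /\ l != 0] (s *: z - m); first exact: Vz.
pose e := d / (2 * k%:R * `|s| + 1).
have c0 : 0 < 2 * k%:R * `|s| + 1 :> R by rewrite ltr_pwDr// !mulr_ge0.
have e0 : 0 < e by rewrite divr_gt0.
apply/nbhs_ballP; exists e => //= x.
rewrite -ball_normE /ball_/= distrC => xz l Ll l0.
have nl : 0 < `|l| by rewrite normr_gt0.
apply: lt_le_trans (slack l (conj Ll l0)).
have -> : s *: x - m = s *: z - m + s *: (x - z).
  by rewrite addrAC -scalerDr (addrC z) subrK.
rewrite dotDl dotZl mulrDr ltrD2l.
apply: le_lt_trans (_ : 2 * (`|s| * (k%:R * (`|x - z| * `|l|))) < _).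
  rewrite ler_pM2l//; apply: le_trans (ler_norm _) _.
  by rewrite normrM ler_wpM2l// dot_norm_le.
have -> : 2 * (`|s| * (k%:R * (`|x - z| * `|l|))) =
  (2 * k%:R * `|s| * `|x - z|) * `|l| by ring.
rewrite ltr_pM2r//.
have -> : d = (2 * k%:R * `|s| + 1) * e by rewrite /e mulrC divfK// gt_eqF.
apply: (@le_lt_trans _ _ (2 * k%:R * `|s| * e)).
  by rewrite ler_wpM2l ?mulr_ge0// ltW.
by rewrite ltr_pM2r// ltrDl.
Qed.

Lemma open_voronoi_nbhs z : open_voronoi z -> nbhs z open_voronoi.
Proof.
have := @open_voronoi_affine_nbhs 1 0 z; rewrite scale1r subr0 => H /H.
by apply: filterS => x /=; rewrite scale1r subr0.
Qed.

(** The constraints of the basis vectors and their opposites bound the products of [x] with the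
    basis; inverting the basis matrix bounds [x]. *)
Lemma voronoi_bounded : exists2 r : R, 0 <= r & forall x, voronoi L x -> `|x| <= r.
Proof.
have [_ _ _ [B [Bunit LB]]] := latL.
pose M := \sum_i dot (row i B) (row i B).
pose C := \sum_i \sum_j `|invmx B^T i j|.
have M0 : 0 <= M by apply: sumr_ge0 => i _; exact: dot_ge0.
have C0 : 0 <= C by apply: sumr_ge0 => i _; exact: sumr_ge0.
exists (M * C); first exact: mulr_ge0.
move=> x /voronoiP Vx; apply: norm_le_coord => [|j]; first exact: mulr_ge0.
have coord i : `|(x *m B^T) 0 i| <= M.
  have -> : (x *m B^T) 0 i = dot x (row i B).
    by rewrite mxE; apply: eq_bigr => a _; rewrite !mxE.
  have iM : dot (row i B) (row i B) <= M.
    by rewrite /M (bigD1 i)//= lerDl; apply: sumr_ge0 => a _; exact: dot_ge0.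
  have := Vx _ (LB i); have := Vx _ (latticeN (LB i)); rewrite !dotE !mulrN opprK => v1 v2.
  by rewrite ler_norml; lra.
have -> : x = (x *m B^T) *m invmx B^T by rewrite mulmxK// unitmx_tr.
rewrite mxE; apply: le_trans (ler_norm_sum _ _ _) _.
rewrite /C mulr_sumr; apply: ler_sum => i _; rewrite normrM ler_pM//.
by rewrite (bigD1 j)//= lerDl sumr_ge0.
Qed.

(** Take for [m] a lattice point nearest to [x]. *)
Lemma voronoi_cover x : exists2 m, L m & voronoi L (x - m).
Proof.
(* A lattice point outside this radius is at distance at least [dot x x + 1] from [x], hence no
   nearer than 0 is, so the search is finite. *)
pose r := `|x| + dot x x + 1.
have /finite_seqP[s sE] := lattice_finite r.
have memE l : l \in s = (`[< L l /\ `|l| <= r >]).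
  by apply/idP/asboolP => H; [change ([set` s] l) in H; rewrite -sE in H|
    change ([set` s] l); rewrite -sE].
have s0 : 0 \in s.
  rewrite memE; apply/asboolP; split; first exact: lattice0.
  by rewrite normr0 !addr_ge0 ?dot_ge0.
have [m ms mmin] := seq_argmin (fun l => dot (x - l) (x - l)) s0.
have [Lm _] : L m /\ `|m| <= r by apply/asboolP; rewrite -memE.
exists m => // l Ll; rewrite enorm_le -addrA -opprD.
have Lml : L (m + l) by exact: latticeD.
have [near|far] := leP `|m + l| r.
  by apply: mmin; rewrite memE; apply/asboolP.
apply: le_trans (mmin 0 s0) _; rewrite subr0.
apply: le_trans (norm_sqr_le_dot _).
have xx := dot_ge0 x.
have big : dot x x + 1 <= `|x - (m + l)|.
  by have := ler_distD x (m + l) 0; rewrite !subr0 (distrC (m + l)); rewrite /r in far; lra.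
by rewrite expr2; nra.
Qed.

Lemma voronoi0 : open_voronoi 0.
Proof. by move=> l _ l0; rewrite dot0l mulr0 dot_gt0. Qed.

Lemma voronoi_shrink (t : R) x : 0 <= t < 1 -> voronoi L x -> open_voronoi (t *: x).
Proof.
move=> /andP[t0 t1] /voronoiP Vx l Ll l0; rewrite dotZl.
by have := Vx l Ll; have := dot_gt0 l0; nra.
Qed.

Lemma open_voronoi_disjoint x m : open_voronoi x -> L m -> m != 0 -> ~ voronoi L (x - m).
Proof.
move=> Vx Lm m0 /voronoiP/(_ _ (latticeN Lm)); have := Vx m Lm m0.
by rewrite !dotE; lra.
Qed.

End Lattice.

(** * Refinement *)

Lemma nbhs_segment (R : realType) (k : nat) (U : set 'rV[R]_k) (x y : 'rV[R]_k) :
  nbhs x U -> exists2 e : R, 0 < e & forall t, 0 < t -> t < e -> U (x + t *: y).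
Proof.
move=> /nbhs_ballP[d /= d0 dU].
have y1 : 0 < `|y| + 1 by rewrite ltr_pwDr.
exists (d / (`|y| + 1)) => [|t t0 td]; first exact: divr_gt0.
apply: dU; rewrite -ball_normE /ball_/= opprD addNKr normrN normrZ gtr0_norm//.
by move: td; rewrite ltr_pdivlMr//; apply: le_lt_trans; rewrite ler_pM2l// lerDl.
Qed.

Lemma nbhs_segment_point (R : realType) (k : nat) (U : set 'rV[R]_k)
    (x y : 'rV[R]_k) :
  nbhs x U -> exists t : R, [/\ 0 < t, t < 1 & U (x + t *: y)].
Proof.
move=> /(nbhs_segment y)[e e0 seg]; pose t := Num.min (e / 2) (1 / 2).
have t0 : 0 < t by rewrite lt_min !divr_gt0.
have te : t < e by rewrite gt_min; apply/orP; left; lra.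
exists t; split => //; last exact: seg.
by rewrite gt_min; apply/orP; right; lra.
Qed.

Section Refinement.
Context {R : realType} {k : nat} (L : set 'rV[R]_k) (lam : R).
Hypotheses (latL : is_lattice L) (lam01 : 0 < lam < 1).
Implicit Types (x y z l m u w f g : 'rV[R]_k).

Let lam0 : 0 < lam. Proof. by case/andP: lam01. Qed.
Let lamE : lam != 0. Proof. by rewrite gt_eqF. Qed.

Definition small_cell m : set 'rV[R]_k :=
  [set lam *: y | y in [set v + m | v in voronoi L]].

Lemma small_cellE m x : small_cell m x <-> voronoi L (lam^-1 *: x - m).
Proof.
split=> [[_ [v Vv <-] <-]|Vx].
  by rewrite scalerA mulVf// scale1r addrK.
exists (lam^-1 *: x); last by rewrite scalerA divff// scale1r.
by exists (lam^-1 *: x - m) => //; rewrite subrK.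
Qed.

(** An interior point of one small cell lies in no other, so a single term survives. *)
Lemma small_cell_sum (a : set 'rV[R]_k -> R) m x :
  L m -> open_voronoi L (lam^-1 *: x - m) ->
  \sum_(d \in scaled lam (tessellation L)) a d * \1_d x = a (small_cell m).
Proof.
move=> Lm Vx.
rewrite -(@fsbig_widen _ _ _ _ [set small_cell m]).
- rewrite fsbig_set1 indicE mem_set ?mulr1//.
  exact/small_cellE/open_voronoiW.
- by move=> _ ->; exists [set v + m | v in voronoi L] => //; exists m.
move=> _ [[_ [l Ll <-] <-] lm]; rewrite /= indicE.
rewrite memNset ?mulr0// => /(small_cellE l) Vl.
have lm0 : l - m != 0.
  by apply/eqP => /eqP; rewrite subr_eq0 => /eqP e; apply: lm; rewrite e.
apply: (open_voronoi_disjoint latL Vx (latticeB latL Ll Lm) lm0).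
by rewrite opprB addrA addrNK.
Qed.

(** Near [z] the identity forces the coefficient of the small cell to be 1. If the cell had a point
    outside V, it would have interior points outside V, where the same coefficient must be 0. *)
Lemma small_cell_subset (a : set 'rV[R]_k -> R) m z :
  Defs.almost_everywhere (fun x => \1_(voronoi L) x =
    \sum_(d \in scaled lam (tessellation L)) a d * \1_d x) ->
  L m -> open_voronoi L z -> open_voronoi L (lam^-1 *: z - m) ->
  small_cell m `<=` voronoi L.
Proof.
move=> ae Lm Vz Vzm p.
have nz := open_voronoi_nbhs latL Vz.
have nm := open_voronoi_affine_nbhs latL Vzm.
have [x [Vx /= Vxm]] := almost_everywhere_ball ae (filterI nz nm).
rewrite (small_cell_sum _ Lm Vxm) indicE mem_set => [am|]; last exact: open_voronoiW.
move=> /small_cellE Vp; apply: contrapT => nVp.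
have [l Ll lp] : exists2 l, L l & dot l l < 2 * dot p l.
  apply: contrapT => nl; apply: nVp; apply/voronoiP => l Ll.
  by rewrite leNgt; apply/negP => lp; apply: nl; exists l.
have np : nbhs p [set x | dot l l / 2 < dot x l].
  apply: (@dot_continuous R k l p [set y | dot l l / 2 < y]).
  by apply: lt_nbhsr; lra.
(* Moving [p] slightly towards the centre [lam *: m] makes it interior to the small cell while it
   still violates the constraint of [l]. *)
have [t [t0 t1 /= lq]] := nbhs_segment_point (lam *: m - p) np.
set q := p + t *: (lam *: m - p) in lq.
have Vq : open_voronoi L (lam^-1 *: q - m).
  have -> : lam^-1 *: q - m = (1 - t) *: (lam^-1 *: p - m).
    apply/rowP => i; rewrite !mxE; field; exact: lamE.
  by apply: voronoi_shrink => //; lra.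
have nq : nbhs q [set x | dot l l / 2 < dot x l].
  apply: (@dot_continuous R k l q [set y | dot l l / 2 < y]).
  by apply: lt_nbhsr; exact: lq.
have [y [/= ly Vym]] := almost_everywhere_ball ae (filterI nq (open_voronoi_affine_nbhs latL Vq)).
rewrite (small_cell_sum _ Lm Vym) -am indicE memNset => [/eqP|/voronoiP/(_ l Ll)].
  by rewrite eq_sym oner_eq0.
by lra.
Qed.

(** The geometric content of refinability, with the coefficients eliminated; the facet arguments
    rest on it. *)
Definition tiled_by_small_cells : Prop := forall m z, L m -> open_voronoi L z ->
  open_voronoi L (lam^-1 *: z - m) -> small_cell m `<=` voronoi L.

Hypothesis tiled : tiled_by_small_cells.

(** Take a small cell containing [f] and move [f] slightly towards its centre: the new point is
    interior to both cells. *)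
Lemma open_voronoi_small_cell f : open_voronoi L f ->
  exists m, [/\ L m, voronoi L (lam^-1 *: f - m) & small_cell m `<=` voronoi L].
Proof.
move=> Vf; have [m Lm Vm] := voronoi_cover latL (lam^-1 *: f).
exists m; split => //.
have nf := open_voronoi_nbhs latL Vf.
have [t [t0 t1 Vt]] := nbhs_segment_point (lam *: m - f) nf.
apply: (tiled Lm Vt).
have -> : lam^-1 *: (f + t *: (lam *: m - f)) - m = (1 - t) *: (lam^-1 *: f - m).
  apply/rowP => i; rewrite !mxE; field; exact: lamE.
by apply: voronoi_shrink => //; lra.
Qed.

Lemma voronoi_small_cell f : voronoi L f ->
  exists m, [/\ L m, voronoi L (lam^-1 *: f - m) & small_cell m `<=` voronoi L].
Proof.
move=> Vf.
have [r r0 Vr] := voronoi_bounded latL.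
(* The radius bounds every [m] whose small cell contains some [(1 - t) *: f] with [0 < t < 1]. *)
have /finite_seqP[s sE] := lattice_finite latL (lam^-1 * `|f| + r).
pose good m := L m /\ small_cell m `<=` voronoi L.
apply: contrapT => nf.
(* Finitely many small cells contain the points [(1 - t) f]; if all of them
   missed [f], they would miss these points for small [t]. *)
have [m d e d0 de H t t0 td|m ms|d d0 sd] := @seq_uniform_eps _ _ s (fun m d =>
    forall t, 0 < t -> t < d -> good m -> ~ voronoi L (lam^-1 *: ((1 - t) *: f) - m)).
- by apply: H => //; exact: lt_le_trans de.
- have [gm|] := pselect (good m); last by exists 1.
  have [l Ll lm] : exists2 l, L l & dot l l < 2 * dot (lam^-1 *: f - m) l.
    apply: contrapT => nl; apply: nf; exists m; case: gm => Lm gm; split => //.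
    apply/voronoiP => l Ll.
    by rewrite leNgt; apply/negP => lp; apply: nl; exists l.
  have np : nbhs (lam^-1 *: f - m) [set x | dot l l / 2 < dot x l].
    apply: (@dot_continuous R k l _ [set y | dot l l / 2 < y]).
    by apply: lt_nbhsr; lra.
  have [e e0 seg] := @nbhs_segment _ _ _ _ (- (lam^-1 *: f)) np.
  exists e => // t t0 te _ /voronoiP/(_ l Ll).
  have -> : lam^-1 *: ((1 - t) *: f) - m = lam^-1 *: f - m + t *: - (lam^-1 *: f).
    by apply/rowP => i; rewrite !mxE; ring.
  by have /= := seg t t0 te; lra.
pose t := Num.min (d / 2) (1 / 2).
have t0 : 0 < t by rewrite lt_min !divr_gt0.
have td : t < d by rewrite gt_min; apply/orP; left; lra.
have t1 : t < 1 by rewrite gt_min; apply/orP; right; lra.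
have [m [Lm Vm Sm]] : exists m, [/\ L m, voronoi L (lam^-1 *: ((1 - t) *: f) - m)
    & small_cell m `<=` voronoi L].
  by apply: open_voronoi_small_cell; apply: voronoi_shrink => //; lra.
apply: (sd m _ t t0 td) => //.
have : [set` s] m; last by [].
rewrite -sE; split => //.
have -> : m = lam^-1 *: ((1 - t) *: f) - (lam^-1 *: ((1 - t) *: f) - m).
  by rewrite opprB addrC subrK.
apply: le_trans (ler_normB _ _) _; apply: lerD; last exact: Vr.
rewrite !normrZ !gtr0_norm ?invr_gt0//; last by lra.
rewrite ler_pM2l ?invr_gt0//; have := normr_ge0 f; nra.
Qed.

(** Here [u] is normal to one facet, [l] is the lattice vector behind another, and [g] is a relative
    interior point of the latter. The gap [w] to the hyperplane of [l] is nonnegative and bounded on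
    the first facet, and each of its values is [lam] times another one, so it vanishes. *)
Lemma facet_subset l g u (b : R) :
  L l -> l != 0 -> voronoi L g -> 2 * dot g l = dot l l ->
  (forall h, L h -> h != 0 -> h != l -> 2 * dot g h < dot h h) ->
  (forall x, voronoi L x -> dot u x <= b) -> 0 < dot u l ->
  forall f, voronoi L f -> dot u f = b -> 2 * dot f l = dot l l.
Proof.
move=> Ll l0 Vg gl gstrict Vu ul.
pose w f := dot l l - 2 * dot f l.
have w0 f : voronoi L f -> 0 <= w f by move/voronoiP/(_ l Ll); rewrite /w; lra.
have [r r0 Vr] := voronoi_bounded latL.
(* [w] measures the distance to the hyperplane of the facet with normal [l]:
   it contracts by [lam] along the self-similarity. *)
have contract f : voronoi L f -> dot u f = b ->
    exists x, [/\ voronoi L x, dot u x = b & w f = lam * w x].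
  move=> Vf uf.
  have [m [Lm Vm Sm]] := voronoi_small_cell Vf.
  set x := lam^-1 *: f - m in Vm.
  have fE : f = lam *: (x + m) by rewrite /x subrK scalerA divff// scale1r.
  have Sx y : voronoi L y -> voronoi L (lam *: (y + m)).
    move=> Vy; apply: Sm; apply/small_cellE.
    by rewrite scalerA mulVf// scale1r addrK.
  (* The test point is [f] itself: it maximises [u] over V, and its copy in the small cell stays in
     V, so [x] is a maximiser too. *)
  have ux : dot u x = b.
    apply/eqP; rewrite eq_le Vu//= -uf.
    have := Vu _ (Sx f Vf); rewrite -uf {2}fE !dotE.
    by rewrite !ler_pM2l// lerD2r.
  exists x; split => //.
  have [g' g'E] : exists g', g' = lam *: (g + m) by eexists.
  have Vg' : voronoi L g' by rewrite g'E; exact: Sx.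
  (* With both [g] and [g'] on the hyperplane of [l], the homothety taking [y] to [lam *: (y + m)]
     preserves that hyperplane and scales [w] by [lam]. *)
  suff g'l : 2 * dot g' l = dot l l.
    move: g'l; rewrite /w g'E fE !dotE => g'l.
    by rewrite -[X in X - _]g'l -gl; ring.
  apply/eqP; rewrite eq_le; have /voronoiP/(_ l Ll) -> /= := Vg'.
  rewrite leNgt; apply/negP => g'l.
  (* The small cell behind [g'] crosses the hyperplane of [u], yet its
     interior meets the segment from [g'] to [g]. *)
  have [|h [[Lh h0] hl]|d d0 slack] :=
      @lattice_slack _ _ L latL [set h | (L h /\ h != 0) /\ h != - l] (g - l).
  - by move=> h [[]].
  - have hl0 : h + l != 0 by rewrite addr_eq0.
    have hll : h + l != l by rewrite -subr_eq0 addrK.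
    have := gstrict _ (latticeD latL Lh Ll) hl0 hll.
    by rewrite !dotE (dotC l h); lra.
  (* Among nonzero vectors only [- l] is tight at [g - l]. Moving along [g - g'] relaxes it, since
     [g'] is strictly inside the half-space of [l], and the slack [d] absorbs the change in the
     other constraints. *)
  have Vgl (t : R) : 0 < t -> t * (2 * k%:R * `|g - g'| + 1) <= d ->
      open_voronoi L (g - l + t *: (g - g')).
    move=> t0 td h Lh h0; have [->|hl] := eqVneq h (- l).
      rewrite !dotE; have : 0 < t * (2 * (dot g l - dot g' l)) by rewrite mulr_gt0//; lra.
      by move=> ?; nra.
    apply: lt_le_trans (slack h _) => //.
    rewrite dotDl mulrDr ltrD2l dotZl.
    have nh : 0 < `|h| by rewrite normr_gt0.
    apply: le_lt_trans (_ : t * (2 * k%:R * `|g - g'|) * `|h| < _).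
      have -> : t * (2 * k%:R * `|g - g'|) * `|h| = 2 * (t * (k%:R * (`|g - g'| * `|h|))) by ring.
      rewrite ler_pM2l// ler_pM2l//; apply: le_trans (dot_norm_le _ _).
      exact: ler_norm.
    by rewrite ltr_pM2r//; apply: lt_le_trans td; rewrite ltr_pM2l// ltrDl.
  pose C := 2 * k%:R * `|g - g'| + 1.
  have C0 : 0 < C by rewrite /C ltr_pwDr// !mulr_ge0.
  pose t := Num.min (d / C) 1.
  have t0 : 0 < t by rewrite lt_min divr_gt0/=.
  have t1 : t <= 1 by rewrite ge_min lexx orbT.
  have td : t * C <= d by rewrite -ler_pdivlMr// ge_min lexx.
  (* This point of the segment from [g'] to [g] is chosen so that rescaling it and subtracting
     [m + l] gives the point of [Vgl]. *)
  pose q := g' + (lam * t) *: (g - g').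
  have Vq : voronoi L q.
    apply/voronoiP => h Lh; rewrite /q !dotE.
    have /voronoiP/(_ h Lh) gh := Vg; have /voronoiP/(_ h Lh) g'h := Vg'.
    have : 0 <= lam * t * (dot h h - 2 * dot g h) by apply: mulr_ge0; [rewrite mulr_ge0 ?ltW|lra].
    have : 0 <= (1 - lam * t) * (dot h h - 2 * dot g' h).
      by rewrite mulr_ge0//; [case/andP: lam01 => _ ?; nra|lra].
    by lra.
  have Vqml : open_voronoi L (lam^-1 *: q - (m + l)).
    have -> : lam^-1 *: q - (m + l) = g - l + t *: (g - g').
      rewrite /q g'E; apply/rowP => i; rewrite !mxE; field; exact: lamE.
    exact: Vgl.
  have [s [s0 s1 Vs]] :=
    nbhs_segment_point (- q) (open_voronoi_affine_nbhs latL Vqml).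
  have Vz : open_voronoi L (q + s *: - q).
    have -> : q + s *: - q = (1 - s) *: q by rewrite scalerBl scale1r scalerN.
    by apply: voronoi_shrink => //; lra.
  have Sml := tiled (latticeD latL Lm Ll) Vz Vs.
  (* The copy of [x] in the neighbouring small cell is [f + lam *: l], where [u] exceeds [b]. *)
  have /Sml/Vu : small_cell (m + l) (lam *: (x + (m + l))).
    by apply/small_cellE; rewrite scalerA mulVf// scale1r addrK.
  rewrite addrA scalerDr -fE dotDr uf dotZr gerDl.
  by rewrite pmulr_rle0// leNgt ul.
pose W := [set w f | f in [set f | voronoi L f /\ dot u f = b]].
have Wub : ubound W (dot l l + 2 * (k%:R * (r * `|l|))).
  move=> _ [f [Vf _] <-]; rewrite /w lerD2l lerNl -mulrN ler_pM2l//.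
  have := dot_norm_le f l; rewrite ler_norml => /andP[fl _]; apply: le_trans fl.
  by rewrite lerN2 ler_wpM2l// ler_wpM2r// Vr.
move=> f Vf uf.
have Wf : W (w f) by exists f.
have hW : has_sup W by split; [exists (w f)|exists (dot l l + 2 * (k%:R * (r * `|l|)))].
have supW : sup W <= lam * sup W.
  apply: ge_sup; first by exists (w f).
  move=> _ [y [Vy uy] <-]; have [x [Vx ux ->]] := contract y Vy uy.
  by rewrite ler_pM2l//; apply: ub_le_sup; [case: hW|exists x].
have wf : w f <= sup W by apply: ub_le_sup; [case: hW|].
have := w0 f Vf; have : 0 < 1 - lam by case/andP: lam01 => _; lra.
rewrite /w in wf *; nra.
Qed.

End Refinement.

(** * Facets *)

Section Facets.
Context {R : realType} {k : nat} (L : set 'rV[R]_k).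
Hypothesis latL : is_lattice L.
Implicit Types (x l g u : 'rV[R]_k).

(** Some nonzero lattice constraint must be tight on the whole face, as otherwise a point of the
    face would be interior to V. Such a vector is parallel to [u], and [b] fixes its length, so it
    is unique. *)
Lemma facet_lattice_vector u (b : R) :
  u != 0 -> (forall x, voronoi L x -> dot u x <= b) ->
  (exists2 x, voronoi L x & dot u x = b) ->
  (forall w c, (forall x, voronoi L x -> dot u x = b -> dot w x = c) ->
    exists t, w = t *: u) ->
  exists l g, [/\ L l, exists2 t, 0 < t & l = t *: u, voronoi L g /\ dot u g = b,
    2 * dot g l = dot l l &
    forall h, L h -> h != 0 -> h != l -> 2 * dot g h < dot h h].
Proof.
move=> u0 Vu [f0 Vf0 uf0] par.
(* A constraint is loose if some point of the face satisfies it strictly. *)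
pose loose h := L h /\ exists x, [/\ voronoi L x, dot u x = b & 2 * dot x h < dot h h].
have [r r0 Vr] := voronoi_bounded latL.
(* Beyond this radius every constraint is strict at every point of V, so only finitely many
   witnesses need averaging. *)
pose r' := 2 * (k%:R * r) + 1.
have /finite_seqP[s sE] := lattice_finite latL r'.
(* Averaging witnesses of the loose constraints gives a relative interior point
   of the facet. *)
have [g [Vg ug gs]] : exists g, [/\ voronoi L g, dot u g = b &
    forall h, h \in s -> loose h -> 2 * dot g h < dot h h].
  elim: s {sE} => [|h s [g [Vg ug gs]]]; first by exists f0.
  have [[Lh [x [Vx ux xh]]]|nh] := pselect (loose h); last first.
    exists g; split => // h'; rewrite inE => /orP[/eqP-> //|]; exact: gs.
  exists (2^-1 *: (g + x)); split.
  - apply/voronoiP => l Ll; rewrite !dotE.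
    have /voronoiP/(_ l Ll) := Vg; have /voronoiP/(_ l Ll) := Vx; lra.
  - by rewrite !dotE ug ux; lra.
  move=> h'; rewrite inE => h's lh'; have [Lh' _] := lh'; rewrite !dotE.
  have /voronoiP/(_ h' Lh') Vg' := Vg; have /voronoiP/(_ h' Lh') Vx' := Vx.
  case/orP: h's => [/eqP hh|/gs/(_ lh')]; last by lra.
  by rewrite hh in Vg' *; lra.
have strict h : loose h -> 2 * dot g h < dot h h.
  move=> lh; have [hr|rh] := leP `|h| r'.
    apply: gs => //; have : [set` s] h; last by [].
    by rewrite -sE; split => //; case: lh.
  apply: lt_le_trans (norm_sqr_le_dot h).
  have nh : 0 < `|h| by apply: le_lt_trans rh; rewrite addr_ge0// !mulr_ge0.
  apply: le_lt_trans (_ : 2 * (k%:R * (r * `|h|)) < _).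
    rewrite ler_pM2l//; apply: le_trans (ler_norm _) _.
    by apply: le_trans (dot_norm_le g h) _; rewrite ler_wpM2l// ler_wpM2r// Vr.
  have -> : 2 * (k%:R * (r * `|h|)) = 2 * (k%:R * r) * `|h| by ring.
  by rewrite expr2 ltr_pM2r//; apply: le_lt_trans rh; rewrite lerDl.
have b0 : 0 <= b by have := Vu 0 (open_voronoiW (@voronoi0 _ _ L)); rewrite dotC dot0l.
have uu := dot_gt0 u0.
(* On the face [h] has the constant product [dot h h / 2], so [h = t *: u]. Comparing [t * b] with
   half of [t ^ 2 * dot u u] determines [t]. *)
have tight h : L h -> h != 0 -> ~ loose h ->
    0 < b /\ h = (2 * b / dot u u) *: u.
  move=> Lh h0 nl.
  have hF x : voronoi L x -> dot u x = b -> dot h x = dot h h / 2.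
    move=> Vx ux; have /voronoiP/(_ h Lh) := Vx; rewrite (dotC h x).
    have [|] := ltP (2 * dot x h) (dot h h) => [xh|]; last by lra.
    by case: nl; split => //; exists x.
  have [t ht] := par h _ hF.
  have hh := dot_gt0 h0.
  have := hF g Vg ug; rewrite {1}ht dotZl ug => tb.
  have tt : dot h h = t * (t * dot u u) by rewrite ht !dotE.
  have t0 : t != 0 by apply: contraTneq hh => t0; rewrite tt t0 mul0r ltxx.
  have tE : t = 2 * b / dot u u.
    apply: (mulIf (lt0r_neq0 uu)); rewrite divfK ?gt_eqF//.
    by apply: (mulfI t0); rewrite -tt; lra.
  rewrite -tE; split => //.
  rewrite lt_neqAle b0 andbT; apply: contraTneq hh => b00.
  by rewrite -leNgt; move: tb; rewrite -b00 mulr0; lra.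
have [[l [[Ll l0] nl]]|none] :=
    pselect (exists l, (L l /\ l != 0) /\ ~ loose l); last first.
  have Vog : open_voronoi L g.
    move=> h Lh h0; apply: strict; apply: contrapT => nh.
    by apply: none; exists h.
  (* From an interior point one can move along [u], which pushes the product with [u] above its
     maximum [b]. *)
  have [t [t0 _ /open_voronoiW/Vu]] :=
    nbhs_segment_point u (open_voronoi_nbhs latL Vog).
  by rewrite dotDr dotZr ug gerDl pmulr_rle0// leNgt uu.
have [bpos lE] := tight l Ll l0 nl.
exists l, g; split => //.
- by exists (2 * b / dot u u) => //; rewrite divr_gt0// mulr_gt0.
- have /voronoiP/(_ l Ll) := Vg.
  have [|] := ltP (2 * dot g l) (dot l l) => [gl|]; last by lra.
  by case: nl; split => //; exists g.
move=> h Lh h0 hl; apply: strict; apply: contrapT => nh.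
by have [_ hE] := tight h Lh h0 nh; rewrite hE lE eqxx in hl.
Qed.

Lemma facet_subset_of_dot_gt0 (lam : R) u v (b b' : R) :
  0 < lam < 1 -> tiled_by_small_cells L lam ->
  (forall x, voronoi L x -> dot u x <= b) -> v != 0 ->
  (forall x, voronoi L x -> dot v x <= b') ->
  (exists2 x, voronoi L x & dot v x = b') ->
  (forall w c, (forall x, voronoi L x -> dot v x = b' -> dot w x = c) ->
    exists t, w = t *: v) ->
  0 < dot u v ->
  forall x, voronoi L x -> dot u x = b -> dot v x = b'.
Proof.
move=> lam01 tiled Vu v0 Vv neG parG uv x Vx ux.
have [l [g [Ll [t t0 lE] [Vg vg] gl gstrict]]] := facet_lattice_vector v0 Vv neG parG.
have l0 : l != 0 by rewrite lE scaler_eq0 negb_or gt_eqF.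
have ul : 0 < dot u l by rewrite lE dotZr mulr_gt0.
have := facet_subset latL lam01 tiled Ll l0 Vg gl gstrict Vu ul Vx ux.
rewrite -gl lE !dotZr !(dotC _ v) vg => e2.
by apply: (mulfI (lt0r_neq0 t0)); lra.
Qed.

End Facets.

(** Moves the facet data back to the cell around the origin; codimension 1 becomes uniqueness of the
    normal up to scaling. *)
Lemma translated_facet (R : realType) (k : nat) (A F : set 'rV[R]_k)
    (z u : 'rV[R]_k) (b : R) :
  let c := [set x + z | x in A] in
  facet c F -> outer_normal c F u -> supports c u b F ->
  [/\ forall x, A x -> dot u x <= b - dot u z,
      exists2 x, A x & dot u x = b - dot u z,
      forall w e, (forall x, A x -> dot u x = b - dot u z -> dot w x = e) ->
        exists t, w = t *: u &
      F = [set x + z | x in [set x | A x /\ dot u x = b - dot u z]]].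
Proof.
move=> c [_ codF] [u0 _] [cu FE].
have FE' : F = [set x + z | x in [set x | A x /\ dot u x = b - dot u z]].
  rewrite FE; apply/seteqP; split.
    move=> _ [[x Ax <-]]; rewrite /hyperplane/= dotDr => uxz.
    by exists x => //; split => //; rewrite -uxz addrK.
  move=> _ [x [Ax ux] <-]; split; first by exists x.
  by rewrite /hyperplane/= dotDr ux subrK.
split => //.
- move=> x Ax; have : c (x + z) by exists x.
  by move/cu; rewrite dotDr lerBrDr.
- have [y] := codim_nonempty codF; rewrite FE' => -[x [Ax ux] _].
  by exists x.
move=> w e we.
apply: (@codim1_normal_parallel _ _ F u w b (e + dot w z)) => //.
  by move=> x; rewrite FE => -[].
by move=> y; rewrite FE' => -[x [Ax ux] <-]; rewrite dotDr we.
Qed.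

Theorem proposition3 (R : realType) (k : nat) (L c : set 'rV[R]_k)
    (latL : is_lattice L)
    (cellc : tessellation L c)
    (reflc : exists F c', [/\ facet c F, facet_reflection c F c' &
                              tessellation L c'])
    (obtc : exists F G, abut c F G /\ obtuse c F G) :
  ~ refinable (tessellation L).
Proof.
move=> [lam [lam01 refL]].
have [F [G [[facF facG FG _] [u [v [nu nv /obtuse_dot_gt0 uv]]]]]] := obtc.
have tiled : tiled_by_small_cells L lam.
  (* Refinability is used for V itself, the cell of the lattice vector 0. *)
  have [|a aE] := refL (voronoi L).
    exists 0; first exact: lattice0 latL.
    apply/seteqP; split => [_ [x Vx <-]|x Vx]; first by rewrite addr0.
    by exists x; rewrite ?addr0.
  by move=> m z Lm Vz Vzm; exact: (small_cell_subset latL lam01 aE Lm Vz Vzm).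
have [z _ cE] := cellc; rewrite -cE in facF facG nu nv.
have [u0 [b sF]] := nu; have [v0 [b' sG]] := nv.
have [Vu neF parF FE] := translated_facet facF nu sF.
have [Vv neG parG GE] := translated_facet facG nv sG.
have vu : 0 < dot v u by rewrite dotC.
have FsubG := facet_subset_of_dot_gt0 latL lam01 tiled Vu v0 Vv neG parG uv.
have GsubF := facet_subset_of_dot_gt0 latL lam01 tiled Vv u0 Vu neF parF vu.
apply: FG; rewrite FE GE; congr image.
by apply/seteqP; split => x [Vx ?]; split => //; [exact: FsubG|exact: GsubF].
Qed.
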